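(* The ordered vector space $(V_{\omega_1},\leqslant_{\omega_1})$ defined in the context has almost Archimedeanization type $\lambda_{V_{\omega_1}}=\omega_1$.
   Context: All vector spaces are real, $\mathbb N=\{1,2,\dots\}$, and $\omega_1$ is the first uncountable ordinal. A pre-ordered vector space (POVS) is a vector space $X$ with a wedge $X_+$ (non-empty, closed under addition and under multiplication by scalars $t\ge0$); $x\le y$ iff $y-x\in X_+$. It is an ordered vector space (OVS) if $X_+\cap -X_+=\{0\}$. An order ideal of $X$ is a vector subspace $A$ such that $a\le x\le b$ with $a,b\in A$ implies $x\in A$; then $X/A$ is pre-ordered by the wedge $[X_+]=\{[x]:x\in X_+\}$. Infinitesimals: $N_X=\{x\in X:\exists\,\xi\in X_+\ \forall n\in\mathbb N\ \ \pm nx+\xi\in X_+\}$. Put $N_0(X)=\{0\}$ and, for every ordinal $\lambda>0$, with $M_\lambda=\bigcup_{\gamma<\lambda}N_\gamma(X)$, put $N_\lambda(X)=\{x\in X:[x]\in N_{X/M_\lambda}\}$ (all $N_\lambda(X)$ and $M_\lambda$ are order ideals of $X$). The almost Archimedeanization type $\lambda_X$ of $X$ is the first ordinal $\lambda$ such that $N_{\lambda+1}(X)=N_\lambda(X)$. Construction of $V_{\omega_1}$: let $\mathcal P$ be the vector space of all real polynomials in one variable, and write $0\leqslant_1 p$ if $p=0$ or the leading coefficient of $p$ is positive. For each countable limit ordinal $\beta$ fix a strictly increasing cofinal sequence $A_\beta:\mathbb N\to\beta$ with values $\ge 1$ (so $A_\beta(n)<A_\beta(m)<\beta$ for $n<m$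 and $\lim_n A_\beta(n)=\beta$). Let $V_{\omega_1}=\bigoplus_{1\leqslant\beta<\omega_1}\mathcal P$, and let $p_\beta$ denote the $\beta$-th coordinate of $p\in V_{\omega_1}$. The order is given by $$0\leqslant_{\omega_1} p\iff \text{for every }\beta\text{ with }1\leqslant\beta<\omega_1:\ 0\leqslant_1 p_\beta\ \text{ and }\ p_\beta(n)\geqslant 0\text{ for all }n\in\mathbb N\text{ with }n\geqslant n_\beta(p),$$ where $n_1(p)=\infty$ (so the second condition is vacuous for $\beta=1$); $n_\beta(p)=\deg p_\gamma$ if $\beta=\gamma+1>1$ (with $\deg 0=-\infty$); and $n_\beta(p)=\min\{n\in\mathbb N: p_{A_\beta(n)}=0\}$ if $\beta$ is a limit ordinal. *)

(* Defs.v *)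
From HB Require Import structures.
From mathcomp Require Import all_boot all_order all_algebra.
From mathcomp Require Import generic_quotient ring_quotient.
From mathcomp Require Import all_classical wochoice all_reals ereal.

Set Implicit Arguments.
Unset Strict Implicit.
Unset Printing Implicit Defensive.

Import Order.TTheory GRing.Theory Num.Theory.

Local Open Scope classical_set_scope.
Local Open Scope ring_scope.

(* Ordinals are represented by well-ordered types.  An element w of such a    *)
(* type stands for the ordinal of its initial segment {v | v < w}; equality   *)
(* of ordinals is order isomorphism, and [ole] is their order.                *)
Record wo_ordinal := WoOrdinal {
  ord_sort :> Type;
  olt : ord_sort -> ord_sort -> Prop;
  olt_trans : forall x y z, olt x y -> olt y z -> olt x z;
  olt_total : forall x y, olt x y \/ x = y \/ olt y x;
  olt_wf : well_founded olt
}.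

Lemma olt_irr (a : wo_ordinal) (x : a) : ~ olt x x.
Proof. by elim/(well_founded_ind (@olt_wf a)): x => x ih xx; exact: (ih x). Qed.

Definition ole (a b : wo_ordinal) : Prop :=
  exists f : a -> b,
    (forall x y, olt x y -> olt (f x) (f y)) /\
    (forall x y, olt y (f x) -> exists z, y = f z).

Definition osucc_lt (a : wo_ordinal) (x y : option a) : Prop :=
  match x, y with
  | Some u, Some v => olt u v
  | Some _, None => True
  | None, _ => False
  end.

Lemma osucc_trans (a : wo_ordinal) (x y z : option a) :
  osucc_lt x y -> osucc_lt y z -> osucc_lt x z.
Proof. by case: x y z => [x|] [y|] [z|] //=; exact: olt_trans. Qed.

Lemma osucc_total (a : wo_ordinal) (x y : option a) :
  osucc_lt x y \/ x = y \/ osucc_lt y x.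
Proof.
case: x y => [x|] [y|] /=; [|by left|by right; right|by right; left].
by case: (olt_total x y) => [|[->|]]; [left|right; left|right; right].
Qed.

Lemma osucc_wf (a : wo_ordinal) : well_founded (@osucc_lt a).
Proof.
have AS : forall u, Acc (@osucc_lt a) (Some u).
  apply: (well_founded_ind (@olt_wf a)) => u ih.
  by apply: Acc_intro => -[v vu|[]]; exact: ih.
by case=> [u|]; [exact: AS|apply: Acc_intro => -[v _|[]]; exact: AS].
Qed.

Definition osucc (a : wo_ordinal) : wo_ordinal :=
  WoOrdinal (@osucc_trans a) (@osucc_total a) (@osucc_wf a).

Definition first_ordinal (P : wo_ordinal -> Prop) (a : wo_ordinal) : Prop :=
  P a /\ forall b, P b -> ole a b.

Definition is_omega1 : wo_ordinal -> Prop :=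
  first_ordinal (fun a => ~ countable [set: a]).

Record povs (R : realType) := Povs {
  povs_sort :> lmodType R;
  wedge : set povs_sort;
  wedge_neq0 : wedge !=set0;
  wedgeD : forall x y, wedge x -> wedge y -> wedge (x + y);
  wedgeZ : forall t x, 0 <= t -> wedge x -> wedge (t *: x)
}.
Arguments wedge {R} p _.

Definition is_ovs (R : realType) (X : povs R) : Prop :=
  forall x, wedge X x -> wedge X (- x) -> x = 0.

Definition infinitesimals (R : realType) (X : povs R) : set X :=
  [set x | exists2 xi, wedge X xi &
     forall n, (0 < n)%N -> wedge X (x *+ n + xi) /\ wedge X (- (x *+ n) + xi)].

Arguments infinitesimals {R} X _.

Definition is_subspace (R : realType) (X : lmodType R) (A : set X) : Prop :=
  [/\ A 0, (forall x y, A x -> A y -> A (x + y)) &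
      (forall t x, A x -> A (t *: x))].

Definition vspan (R : realType) (X : lmodType R) (A : set X) : set X :=
  [set x | forall B, is_subspace B -> A `<=` B -> B x].

Lemma infinitesimals_subspace (R : realType) (X : povs R) :
  is_subspace (infinitesimals X).
Proof.
split=> [|x y [xi Xxi hx] [eta Xeta hy]|t x [xi Xxi hx]].
- have [xi Xxi] := wedge_neq0 X; exists xi => // n _.
  by rewrite mul0rn oppr0 add0r.
- exists (xi + eta) => [|n n0]; first exact: wedgeD.
  have [x1 x2] := hx n n0; have [y1 y2] := hy n n0.
  by rewrite mulrnDl opprD; split; rewrite addrACA; exact: wedgeD.
- exists (`|t| *: xi) => [|n n0]; first exact: wedgeZ.
  have [x1 x2] := hx n n0; rewrite scalerMnr -scalerN; have [t0|t0] := leP 0 t.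
    by rewrite (ger0_norm t0) -!scalerDr; split; exact: wedgeZ.
  have E (y : X) : t *: y = - t *: - y by rewrite scalerN scaleNr opprK.
  have t1 : 0 <= - t by rewrite oppr_ge0 ltW.
  by rewrite !E opprK (ltr0_norm t0) -!scalerDr; split; exact: wedgeZ.
Qed.

Lemma vspan_subspace (R : realType) (X : lmodType R) (A : set X) :
  is_subspace (vspan A).
Proof.
split=> [B [? _ _] _//|x y hx hy B sB AB|t x hx B sB AB].
  by have [_ D _] := sB; apply: D; [exact: hx|exact: hy].
by have [_ _ Z] := sB; apply: Z; exact: hx.
Qed.

Lemma vspan_id (R : realType) (X : lmodType R) (A : set X) :
  is_subspace A -> vspan A = A.
Proof.
by move=> sA; apply/seteqP; split=> x; [apply=> //|move=> Ax B _; exact].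
Qed.

Definition vspan_pred (R : realType) (X : lmodType R) (A : set X) : {pred X} :=
  fun x => `[< vspan A x >].

Lemma vspan_zmod_closed (R : realType) (X : lmodType R) (A : set X) :
  zmod_closed (vspan_pred A).
Proof.
have [S0 SD SZ] := vspan_subspace A.
split=> [|x y /asboolP xA /asboolP yA]; apply/asboolP => //.
by apply: SD => //; rewrite -scaleN1r; exact: SZ.
Qed.

HB.instance Definition _ (R : realType) (X : lmodType R) (A : set X) :=
  GRing.isZmodClosed.Build X (vspan_pred A) (vspan_zmod_closed A).

(* The quotient of X by the span of A, that is X / A when A is a subspace     *)
(* ([vspan_id]).                                                               *)
Section Quotient.
Variables (R : realType) (X : povs R) (A : set X).
Local Open Scope quotient_scope.

Definition quot_sort : Type := Quotient.quot (vspan_pred A).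
HB.instance Definition _ := GRing.Zmodule.on quot_sort.

Definition quot_pi (x : X) : quot_sort := \pi_(Quotient.quot (vspan_pred A)) x.

Lemma quot_piP x y : quot_pi x = quot_pi y <-> vspan A (x - y).
Proof.
rewrite -(asboolE (vspan A _)) -/(vspan_pred A (x - y)).
have -> : vspan_pred A (x - y) = (x - y \in vspan_pred A) by [].
by rewrite Quotient.idealrBE; split=> /eqP.
Qed.

Lemma quot_pi_surj (q : quot_sort) : exists x, q = quot_pi x.
Proof. by exists (repr q); rewrite /quot_pi reprK. Qed.

Lemma quot_piD x y : quot_pi (x + y) = quot_pi x + quot_pi y.
Proof. exact: raddfD. Qed.

Lemma quot_piB x y : quot_pi (x - y) = quot_pi x - quot_pi y.
Proof. exact: raddfB. Qed.

Definition quot_scale (t : R) (q : quot_sort) : quot_sort :=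
  quot_pi (t *: repr q).

Lemma quot_piZ t x : quot_pi (t *: x) = quot_scale t (quot_pi x).
Proof.
apply/quot_piP; rewrite -scalerBr; have [_ _] := vspan_subspace A; apply.
by apply/quot_piP; rewrite /quot_pi reprK.
Qed.

Lemma quot_scaleA s t q : quot_scale s (quot_scale t q) = quot_scale (s * t) q.
Proof. by have [x ->] := quot_pi_surj q; rewrite -!quot_piZ scalerA. Qed.

Lemma quot_scale1 : left_id 1 quot_scale.
Proof. by move=> q; have [x ->] := quot_pi_surj q; rewrite -quot_piZ scale1r. Qed.

Lemma quot_scaleDr : right_distributive quot_scale +%R.
Proof.
move=> t q r; have [x ->] := quot_pi_surj q; have [y ->] := quot_pi_surj r.
by rewrite -quot_piD -!quot_piZ scalerDr quot_piD.
Qed.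

Lemma quot_scaleDl q : {morph quot_scale^~ q : s t / s + t}.
Proof.
move=> s t; have [x ->] := quot_pi_surj q.
by rewrite -!quot_piZ scalerDl quot_piD.
Qed.

HB.instance Definition _ := GRing.Zmodule_isLmodule.Build R quot_sort
  quot_scaleA quot_scale1 quot_scaleDr quot_scaleDl.

Definition quot_wedge : set quot_sort := quot_pi @` wedge X.

Lemma quot_wedge_neq0 : quot_wedge !=set0.
Proof. by have [x Xx] := wedge_neq0 X; exists (quot_pi x), x. Qed.

Lemma quot_wedgeD q r : quot_wedge q -> quot_wedge r -> quot_wedge (q + r).
Proof.
move=> [x Xx <-] [y Xy <-]; exists (x + y); first exact: wedgeD.
exact: quot_piD.
Qed.

Lemma quot_wedgeZ (t : R) q : 0 <= t -> quot_wedge q -> quot_wedge (t *: q).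
Proof.
move=> t0 [x Xx <-]; exists (t *: x); first exact: wedgeZ.
exact: quot_piZ.
Qed.

Definition povs_quot : povs R :=
  @Povs R quot_sort quot_wedge quot_wedge_neq0 quot_wedgeD quot_wedgeZ.

End Quotient.

Section Almost_Archimedeanization.
Variables (R : realType) (X : povs R).

(* The passage from the family (N_g), g < l, to N_l. *)
Definition N_step (I : Type) (N : I -> set X) : set X :=
  if `[< inhabited I >] then
    [set x | infinitesimals (povs_quot (\bigcup_i N i))
               (quot_pi (\bigcup_i N i) x)]
  else [set 0].

Definition N_at (l : wo_ordinal) : l -> set X :=
  Fix (@olt_wf l) (fun=> set X)
    (fun w rec => N_step (fun v : {v | olt v w} => rec (sval v) (svalP v))).

Definition N_ord (l : wo_ordinal) : set X := N_step (@N_at l).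

Definition is_aa_type : wo_ordinal -> Prop :=
  first_ordinal (fun l => N_ord (osucc l) = N_ord l).

Lemma N_atE (l : wo_ordinal) (w : l) :
  N_at w = N_step (fun v : {v | olt v w} => N_at (sval v)).
Proof.
rewrite {1}/N_at Fix_eq // => x f g fg; congr N_step.
by apply/funext => v; exact: fg.
Qed.

Lemma N_step_subspace (I : Type) (N : I -> set X) : is_subspace (N_step N).
Proof.
rewrite /N_step; case: ifP => _; last first.
  by split=> [|x y -> ->|t x ->] //=; rewrite ?addr0 ?scaler0.
set M := \bigcup_i N i.
have [S0 SD SZ] := infinitesimals_subspace (povs_quot M).
split=> [|x y hx hy|t x hx] /=.
- have -> : quot_pi M 0 = 0 by rewrite -(subrr 0) quot_piB subrr.
  exact: S0.
- by rewrite quot_piD; exact: SD.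
- by rewrite quot_piZ; exact: SZ.
Qed.

Lemma N_step_ub (I : Type) (N : I -> set X) (i : I) : N i `<=` N_step N.
Proof.
rewrite /N_step asboolT; last by constructor.
move=> x Nx /=; set M := \bigcup_i N i.
have -> : quot_pi M x = 0.
  rewrite -(subrr (quot_pi M 0)) -quot_piB subrr; apply/quot_piP => B _; apply.
  by exists i => //; rewrite subr0.
by have [S0 _ _] := infinitesimals_subspace (povs_quot M).
Qed.

Lemma N_at_homo (l : wo_ordinal) (v w : l) : olt v w -> N_at v `<=` N_at w.
Proof.
move=> vw; rewrite (N_atE w).
exact: (@N_step_ub {v | olt v w} (fun v => N_at (sval v)) (exist _ v vw)).
Qed.

(* The sets M_l are subspaces, so the quotients above are the expected ones. *)
Lemma bigcup_N_at_subspace (l : wo_ordinal) (I : Type) (g : I -> l) :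
  inhabited I -> is_subspace (\bigcup_i N_at (g i)).
Proof.
have NS w : is_subspace (@N_at l w) by rewrite N_atE; exact: N_step_subspace.
move=> [i0]; split=> [|x y [i _ xi] [j _ yj]|t x [i _ xi]].
- by exists i0 => //; have [] := NS (g i0).
- have [ij|[ij|ji]] := olt_total (g i) (g j).
  + by exists j => //; have [_ D _] := NS (g j); apply: D => //; exact: N_at_homo xi.
  + by exists j => //; have [_ D _] := NS (g j); apply: D => //; rewrite -ij.
  + by exists i => //; have [_ D _] := NS (g i); apply: D => //; exact: N_at_homo yj.
- by exists i => //; have [_ _ Z] := NS (g i); exact: Z.
Qed.

End Almost_Archimedeanization.

Section Direct_sum.
Variables (R : realType) (I : Type) (M : lmodType R).

Definition fin_supp : {pred I -> M} :=
  fun f => `[< finite_set [set i | f i != 0] >].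

Lemma fin_supp_submod_closed : submod_closed fin_supp.
Proof.
split=> [|t f g /asboolP ff /asboolP fg]; apply/asboolP.
  by rewrite (_ : [set _ | _] = set0) // -subset0 => i /=; rewrite eqxx.
apply: (@sub_finite_set _ _ ([set i | f i != 0] `|` [set i | g i != 0])).
  move=> i /=; apply: contraPP => /not_orP[/negP/negPn/eqP fi /negP/negPn/eqP gi].
  by apply/negP/negPn/eqP; rewrite fctE /= gi addr0 -[LHS]/(t *: f i) fi scaler0.
by rewrite finite_setU.
Qed.

HB.instance Definition _ :=
  GRing.isSubmodClosed.Build R (I -> M) fin_supp fin_supp_submod_closed.

Record dsum := Dsum { dsum_fun :> I -> M; _ : dsum_fun \in fin_supp }.
HB.instance Definition _ := [isSub for dsum_fun].
HB.instance Definition _ := [Choice of dsum by <:].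
HB.instance Definition _ := [SubChoice_isSubLmodule of dsum by <:].

End Direct_sum.

Section V.
Variables (R : realType) (W : wo_ordinal).

(* The ordinals b with 1 <= b < W. *)
Definition pos_ord : Type := {b : W | exists c, olt c b}.
Definition plt (b c : pos_ord) : Prop := olt (sval b) (sval c).
Definition is_one (b : pos_ord) : Prop := forall c, ~ plt c b.
Definition is_succ_of (c b : pos_ord) : Prop :=
  plt c b /\ forall d, ~ (plt c d /\ plt d b).
Definition is_limit (b : pos_ord) : Prop :=
  ~ is_one b /\ ~ exists c, is_succ_of c b.

(* The naturals of the paper start at 1: the value A b 0 is irrelevant. *)
Definition fundamental (A : pos_ord -> nat -> pos_ord) : Prop :=
  forall b, is_limit b ->
    [/\ forall n m, (0 < n < m)%N -> plt (A b n) (A b m),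
        forall n, (0 < n)%N -> plt (A b n) b &
        forall c, plt c b -> exists2 n, (0 < n)%N & plt c (A b n)].

Variable A : pos_ord -> nat -> pos_ord.

Definition poly_pos (p : {poly R}) : Prop := p = 0 \/ 0 < lead_coef p.

Definition poly_deg (p : {poly R}) : \bar R :=
  if p == 0 then -oo%E else (size p).-1%:R%:E.

Local Notation V_sort := (dsum pos_ord {poly R}).

(* The threshold n_b(p); the infimum below is the minimum of a set of natural *)
(* numbers, nonempty when A is fundamental since p has finite support.        *)
Definition thr (p : V_sort) (b : pos_ord) : \bar R :=
  if pselect (is_one b) then +oo%E else
  match pselect (exists c, is_succ_of c b) with
  | left h => poly_deg (p (sval (cid h)))
  | right _ => ereal_inf
      [set n%:R%:E | n in [set n : nat | (0 < n)%N /\ p (A b n) = 0]]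
  end.

Definition V_wedge : set V_sort :=
  [set p : V_sort | forall b, poly_pos (p b) /\
     forall n, (0 < n)%N -> (thr p b <= n%:R%:E)%E -> 0 <= (p b).[n%:R]].

Lemma dsum0E b : (0 : V_sort) b = 0.
Proof. by []. Qed.

Lemma dsumDE (p q : V_sort) b : (p + q) b = p b + q b.
Proof. by []. Qed.

Lemma dsumZE t (p : V_sort) b : (t *: p) b = t *: p b.
Proof. by []. Qed.

Lemma dsumNE (p : V_sort) b : (- p) b = - p b.
Proof. by []. Qed.

Lemma poly_pos_ge0 p : poly_pos p -> 0 <= lead_coef p.
Proof. by case=> [->|/ltW//]; rewrite lead_coef0. Qed.

Lemma poly_posD p q : poly_pos p -> poly_pos q ->
  [/\ poly_pos (p + q), (poly_deg p <= poly_deg (p + q)%R)%E &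
      p + q = 0 -> p = 0].
Proof.
move=> [->|p0]; first by rewrite add0r /poly_deg eqxx leNye.
move=> [->|q0]; first by rewrite addr0; split=> //; right.
have pn0 : p != 0 by apply: contraTneq p0 => ->; rewrite lead_coef0 ltxx.
have [|] := boolP (size q < size p)%N => [qp|].
  have E := lead_coefDl qp.
  have S := size_polyDl qp.
  have n0 : p + q != 0 by rewrite -size_poly_eq0 S size_poly_eq0.
  split; [by right; rewrite E|by rewrite /poly_deg (negPf n0) (negPf pn0) S|].
  by move=> /eqP; rewrite (negPf n0).
rewrite -leqNgt leq_eqVlt => /orP[/eqP pq|pq].
  have l : 0 < (p + q)`_(size p).-1.
    by rewrite coefD {2}pq addr_gt0.
  have n0 : p + q != 0.
    by apply: contraTneq l => ->; rewrite coef0 ltxx.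
  have S : size (p + q) = size p.
    apply/eqP; rewrite eqn_leq; apply/andP; split.
      by rewrite (leq_trans (size_polyD _ _))// -pq maxnn.
    rewrite leqNgt; apply/negP => h; move: l.
    rewrite nth_default ?ltxx// -ltnS prednK// lt0n size_poly_eq0//.
  split; [by right; rewrite lead_coefE S|by rewrite /poly_deg (negPf n0) (negPf pn0) S|].
  by move=> /eqP; rewrite (negPf n0).
have E := lead_coefDr pq.
have S : size (p + q) = size q by rewrite addrC; exact: size_polyDl.
have qn0 : q != 0 by apply: contraTneq q0 => ->; rewrite lead_coef0 ltxx.
have n0 : p + q != 0 by rewrite -size_poly_eq0 S size_poly_eq0.
split; [by right; rewrite E| |by move=> /eqP; rewrite (negPf n0)].
by rewrite /poly_deg (negPf n0) (negPf pn0) S lee_fin ler_nat -!subn1 leq_sub2r// ltnW.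
Qed.

Lemma thrD (p q : V_sort) b : (forall c, poly_pos (p c)) -> (forall c, poly_pos (q c)) ->
  (thr p b <= thr (p + q)%R b)%E.
Proof.
move=> p0 q0; rewrite /thr; case: pselect => //= _; case: pselect => /= [h|_].
  by have [_ + _] := poly_posD (p0 (sval (cid h))) (q0 (sval (cid h))).
apply: ereal_inf_le_tmp => _ [n [n0 /= pq] <-]; exists n => //; split=> //.
by have [_ _] := poly_posD (p0 (A b n)) (q0 (A b n)); exact.
Qed.

Lemma thrZ t (p : V_sort) b : t != 0 -> thr (t *: p) b = thr p b.
Proof.
move=> t0; rewrite /thr; case: pselect => //= _; case: pselect => /= [h|_].
  have degZ (f : {poly R}) : poly_deg (t *: f) = poly_deg f.
    by rewrite /poly_deg scaler_eq0 (negPf t0) size_scale.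
  exact: degZ.
have tp0 c : (dsum_fun (t *: p) c = 0) = (p c = 0).
  rewrite dsumZE; apply/propext; split=> [/eqP|->]; last by rewrite scaler0.
  by rewrite scaler_eq0 (negPf t0) => /eqP.
congr (ereal_inf [set _ | _ in _]); apply/seteqP.
by split=> n /= [n0 pn]; split=> //; have := pn; rewrite tp0.
Qed.

Lemma V_wedge0 : V_wedge 0.
Proof. by move=> b; split=> [|n _ _]; [left|rewrite dsum0E horner0]. Qed.

Lemma V_wedgeD (p q : V_sort) : V_wedge p -> V_wedge q -> V_wedge (p + q).
Proof.
move=> Vp Vq.
have p0 c : poly_pos (p c) by have [] := Vp c.
have q0 c : poly_pos (q c) by have [] := Vq c.
move=> b; rewrite dsumDE; split=> [|n n0 nb].
  by have [] := poly_posD (p0 b) (q0 b).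
rewrite hornerD addr_ge0//.
- by have [_] := Vp b; apply=> //; exact: le_trans (thrD _ p0 q0) nb.
- have [_] := Vq b; apply=> //; apply: le_trans (thrD _ q0 p0) _.
  by rewrite addrC.
Qed.

Lemma V_wedgeZ t (p : V_sort) : 0 <= t -> V_wedge p -> V_wedge (t *: p).
Proof.
rewrite le_eqVlt => /orP[/eqP <- _|t0 Vp b]; first by rewrite scale0r; exact: V_wedge0.
have [p0 pb] := Vp b; rewrite dsumZE; split=> [|n n0].
  case: p0 => [->|p0]; first by left; rewrite scaler0.
  by right; rewrite lead_coefZ mulr_gt0.
rewrite thrZ ?gt_eqF// => nb; rewrite hornerZ mulr_ge0 ?(ltW t0)//.
exact: pb.
Qed.

Definition V : povs R := @Povs R V_sort V_wedge
  (ex_intro _ 0 V_wedge0) V_wedgeD V_wedgeZ.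

Lemma V_ovs : is_ovs V.
Proof.
move=> p Vp VNp; apply/val_inj/funext => b /=.
have [p0 _] := Vp b; have [q0 _] := VNp b.
have := poly_pos_ge0 q0; rewrite dsumNE lead_coefN oppr_ge0 => l0.
by case: p0 => // /lt_le_trans/(_ l0); rewrite ltxx.
Qed.

End V.

Lemma wf_of_min (T : Type) (lt : T -> T -> Prop) :
  (forall B : set T, B !=set0 -> exists2 x, B x & forall y, B y -> ~ lt y x) ->
  well_founded lt.
Proof.
move=> h x; apply: contrapT => nx.
have [y ny ymin] := h [set y | ~ Acc lt y] (ex_intro _ x nx).
by apply: ny; constructor => z /(contraPnot (ymin z)) /contrapT.
Qed.

Lemma olt_min (a : wo_ordinal) (B : set a) : B !=set0 ->
  exists2 x, B x & forall y, B y -> ~ olt y x.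
Proof.
move=> [x]; apply: contraPP => h.
elim/(well_founded_ind (@olt_wf a)): x => x ih Bx.
by apply: h; exists x => // y By /ih; exact.
Qed.

Lemma wo_exists (T : eqType) : exists lt : T -> T -> Prop,
  [/\ forall x y z, lt x y -> lt y z -> lt x z,
      forall x y, lt x y \/ x = y \/ lt y x & well_founded lt].
Proof.
have [r wo] := well_ordering_principle T.
have min2 x y : exists z, minimum_of r [pred u | (u == x) || (u == y)] z.
  have [|z [? _]] := wo [pred u | (u == x) || (u == y)].
    by exists x; rewrite inE eqxx.
  by exists z.
have rtot x y : r x y || r y x.
  have [z [zxy zmin]] := min2 x y; move: zxy; rewrite inE => /orP[]/eqP zE.
    by rewrite -{1}zE zmin// inE eqxx orbT.
  by rewrite -{2}zE zmin ?orbT// inE eqxx.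
have rxx x : r x x by have := rtot x x; rewrite orbb.
have ranti x y : r x y -> r y x -> x = y.
  move=> xy yx.
  have [|z [_ zu]] := wo [pred u | (u == x) || (u == y)].
    by exists x; rewrite inE eqxx.
  rewrite -(zu x); last first.
    by split=> [|u]; rewrite inE ?eqxx// => /orP[]/eqP->.
  by apply: zu; split=> [|u]; rewrite inE ?eqxx ?orbT// => /orP[]/eqP->.
have rmin (B : {pred T}) x : x \in B -> exists2 z, z \in B & forall y, y \in B -> r z y.
  by move=> Bx; have [|z [[zB zl] _]] := wo B; [exists x|exists z].
have rtr x y z : r x y -> r y z -> r x z.
  move=> xy yz.
  have [|w wB wl] := @rmin [pred u | [|| u == x, u == y | u == z]] x.
    by rewrite inE eqxx.
  have wx := wl x; have wy := wl y; have wz := wl z; move: wB wx wy wz.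
  rewrite !inE !eqxx !orbT => /or3P[]/eqP-> wx wy wz; [exact: wz| |].
    by rewrite (ranti _ _ xy (wx isT)).
  by rewrite -(ranti _ _ yz (wy isT)).
exists (fun x y => ~~ r y x); split=> [x y z yx zy|x y|].
- apply/negP => zx; have xy : r x y by have := rtot x y; rewrite (negPf yx) orbF.
  by rewrite (rtr _ _ _ zx xy) in zy.
- have [yx|yx] := boolP (r y x); last by left.
  have [xy|xy] := boolP (r x y); last by right; right.
  by right; left; exact: ranti.
- apply: wf_of_min => B [x Bx].
  have [|z zB zl] := @rmin (fun u => `[< B u >]) x; first exact/asboolP.
  exists z; first exact/asboolP.
  by move=> y By; apply/negP; rewrite negbK; apply: zl; exact/asboolP.
Qed.

Lemma uncountable_set_nat : ~ countable [set: set nat].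
Proof.
move=> /pcard_injP [f finj].
pose D := [set n | exists2 B : set nat, f B = n & ~ B n].
have fI (B C : set nat) : f B = f C -> B = C by apply: finj; rewrite inE.
have [DD|nD] := pselect (D (f D)).
  by have [B BD nB] := DD; apply: nB; rewrite (fI _ _ BD).
by apply: (nD); exists D.
Qed.

Section Omega1.
Variables (T : Type) (lt : T -> T -> Prop).
Hypotheses (lttr : forall x y z, lt x y -> lt y z -> lt x z)
  (lttot : forall x y, lt x y \/ x = y \/ lt y x) (ltwf : well_founded lt)
  (Tunc : ~ countable [set: T]).

Definition om := {x : T | countable [set y | lt y x]}.
Definition omlt (x y : om) := lt (sval x) (sval y).

Definition om_ord : wo_ordinal.
Proof.
apply: (@WoOrdinal om omlt).
- by move=> x y z; exact: lttr.
- move=> [x px] [y py]; rewrite /omlt /=; case: (lttot x y) => [|[xy|]]; [by left| |by right; right].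
  by right; left; exact: eq_exist.
- suff h y : forall x : om, sval x = y -> Acc omlt x by move=> x; exact: h erefl.
  elim/(well_founded_ind ltwf): y => y ih x xy; constructor => z zx.
  by apply: (ih (sval z)) => //; rewrite -xy.
Defined.

Lemma om_unc : ~ countable [set: om_ord].
Proof.
move=> c.
have cS : countable [set x | countable [set y | lt y x]].
  apply: (sub_countable _ c).
  rewrite (_ : [set x | _] = range (fun x : om_ord => sval x)); first exact: card_image_le.
  by apply/seteqP; split=> [x px|_ [[x px] _ <-]//]; exists (exist _ x px).
pose D := WoOrdinal lttr lttot ltwf.
have [|x nx xm] := @olt_min D (~` [set x | countable [set y | lt y x]]).
  apply/set0P/eqP => E; apply: Tunc.
  by rewrite -(setCK [set: T]) setCT -E setCK.
apply: nx; apply: sub_countable cS; apply: subset_card_le => y yx.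
by apply: contrapT => ny; exact: (xm y).
Qed.

Lemma om_first (b : wo_ordinal) : ~ countable [set: b] -> ole om_ord b.
Proof.
move=> bu.
have next (B : set b) : countable B -> exists x, ~ B x /\ forall y, ~ B y -> ~ olt y x.
  move=> cB; have [|x Bx xm] := @olt_min b (~` B).
    apply/set0P/eqP => E; apply: bu; by rewrite -setC0 -E setCK.
  by exists x.
have /choice[nx nxP] : forall B : set b, exists x,
    countable B -> ~ B x /\ forall y, ~ B y -> ~ olt y x.
  move=> B; have [/next[x xP]|nB] := pselect (countable B); first by exists x.
  by have [x _] := next set0 (countable0 _); exists x.
pose F := Fix (@olt_wf om_ord) (fun=> b) (fun w rec =>
  nx [set y | exists v (vw : olt v w), rec v vw = y]).
have FE w : F w = nx (F @` [set v | olt v w]).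
  rewrite {1}/F Fix_eq => [|x f g fg]; congr nx.
    by apply/seteqP; split=> [y [v [vw <-]]|y [v vw <-]]; exists v => //; exists vw.
  by apply/seteqP; split=> y [v [vw <-]]; exists v, vw.
have cw (w : om_ord) : countable [set v | olt v w].
  apply: sub_countable (svalP w).
  rewrite -(card_le_eql (inj_card_eq (f := fun v : om_ord => sval v) _)).
    by apply: subset_card_le => _ [v vw <-].
  by move=> [x px] [y py] _ _ /= xy; exact: eq_exist.
have FP w : ~ (F @` [set v | olt v w]) (F w) /\
    forall y, ~ (F @` [set v | olt v w]) y -> ~ olt y (F w).
  by rewrite FE; exact: nxP (sub_countable (card_image_le F _) (cw w)).
exists F; split=> [v w vw|w y yw].
  have [Fw _] := FP w; have [_ Fv] := FP v.
  have [//|[E|wv]] := olt_total (F v) (F w).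
    by case: Fw; exists v.
  exfalso; apply: Fv wv => -[u uv E]; apply: Fw; exists u => //.
  exact: olt_trans vw.
have [_ Fw] := FP w; apply: contrapT => ny; apply: Fw yw => -[z _ zy].
by apply: ny; exists z.
Qed.

End Omega1.

Lemma omega1_exists : exists a, is_omega1 a.
Proof.
have [lt [lttr lttot ltwf]] := wo_exists (set nat).
exists (om_ord lttr lttot ltwf); split; last exact: om_first.
exact: om_unc uncountable_set_nat.
Qed.

(* Main.v *)
Require Import Defs.
From mathcomp Require Import all_boot all_order all_algebra.
From mathcomp Require Import all_classical all_reals ereal.
From mathcomp Require polyrcf.

(** For an ordinal [l < omega_1], the stage [N_l] consists of the elements whose
support lies in [[1, l]], and for [l = omega_1] it is the whole space.  As the
stages below [omega_1] are pairwise different, the type is [omega_1].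

All stages, finite, successor or limit, come from one computation.  Let [D] be
a nonempty initial segment of the ordinals, and factor out the elements
supported in [D].  The infinitesimals of the quotient are the classes of the
elements supported in [D] together with the least ordinal outside [D].

- They contain no more than that ([infinitesimal_supp_next]).  Suppose that
  some [c < b] is outside [D], and that [xi + n x] and [xi - n x] are positive
  in the quotient for all [n].  The threshold at [b] is bounded by means of
  a single earlier coordinate: the predecessor of [b], or a late point of the
  fundamental sequence at which [x] and [xi] vanish.  That coordinate is outside
  [D], so the representatives agree there with [xi + n x] and [xi - n x], and
  the bound does not depend on [n].  At each large integer [m] the numbers [n * x_b(m)]
  are then bounded by [xi_b(m)], so [x_b(m) = 0] because the reals are
  Archimedean, and the polynomial [x_b] vanishes.

- They contain all of it ([supp_next_infinitesimal]).  If all the ordinals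
  below [b] are in [D], the coordinates below [b] can be chosen freely within
  a class, and so large a threshold at [b] can be arranged that any polynomial
  with positive leading coefficient is allowed at [b] ([V_wedge_lift]).  So at
  [b] only the order of the leading coefficient remains, in which any
  polynomial is infinitesimal with respect to a power of ['X] of higher degree.

Well-founded induction then gives the stages along any initial embedding of
a well-order into [omega_1] ([N_ord_supp_next]).  An uncountable ordinal is at
least [omega_1] by definition, so only countable ones must be excluded.  A countable ordinal embeds
onto a proper initial segment [{c | c < w}]; the polynomial 1 placed at the
successor of [w] belongs to the next stage and not to this one. *)

Set Implicit Arguments.
Unset Strict Implicit.
Unset Printing Implicit Defensive.

Import Order.TTheory GRing.Theory Num.Theory.
Local Open Scope classical_set_scope.
Local Open Scope ring_scope.

(** * Directed relations and finite sets *)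

Lemma seq_directed (T : eqType) (I : Type) (r : I -> T -> Prop) (s : seq T) :
  inhabited I ->
  (forall i j, exists k, forall t, r i t \/ r j t -> r k t) ->
  (forall t, t \in s -> exists i, r i t) ->
  exists i, forall t, t \in s -> r i t.
Proof.
move=> [i0] rdir; elim: s => [_|t s ih rF]; first by exists i0.
have [i it] := rF t (mem_head _ _).
have [|j js] := ih; first by move=> u us; apply: rF; rewrite inE us orbT.
have [k ijk] := rdir i j; exists k => u /=; rewrite inE => /orP[/eqP->|us].
  by apply: ijk; left.
by apply: ijk; right; exact: js.
Qed.

(** Makes uniform a choice of bounds over a finite support.  The index [i] is an
ordinal bounding the support, or a rank after which a fundamental sequence
avoids it. *)
Lemma finite_set_directed (T I : Type) (r : I -> T -> Prop) (F : set T) :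
  inhabited I ->
  (forall i j, exists k, forall t, r i t \/ r j t -> r k t) ->
  finite_set F -> (forall t, F t -> exists i, r i t) ->
  exists i, forall t, F t -> r i t.
Proof.
move=> I0 rdir /(@finite_seqP {classic T})[s ->].
exact: (@seq_directed {classic T}).
Qed.

(** * Signs of polynomials at large integers *)

Section Polynomials.
Variable R : realType.
Implicit Types f g : {poly R}.

Lemma lead_coef_gt0_eventually f : 0 < lead_coef f ->
  exists m0 : nat, forall m, (m0 <= m)%N -> 0 < f.[m%:R].
Proof.
move=> f0; have [x fx] := polyrcf.poly_pinfty_gt_lc f0.
exists (Num.trunc x).+1 => m xm; apply: lt_le_trans f0 _; apply: fx.
by apply: le_trans (ltW (truncnS_gt x)) _; rewrite ler_nat.
Qed.

Lemma poly_pos_eventually f : poly_pos f ->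
  exists m0 : nat, forall m, (m0 <= m)%N -> 0 <= f.[m%:R].
Proof.
case=> [->|/lead_coef_gt0_eventually[m0 h]]; first by exists 0%N => m; rewrite horner0.
by exists m0 => m /h/ltW.
Qed.

(** A nonzero [f] does not vanish at large [m]; at one such [m] the multiples of
[f.[m]] are unbounded, while [g.[m]] is a fixed number. *)
Lemma poly_pos_eventually_eq0 f g (K : nat) :
  (forall n, (0 < n)%N -> forall m, (K <= m)%N ->
     0 <= (f *+ n + g).[m%:R] /\ 0 <= (- (f *+ n) + g).[m%:R]) ->
  f = 0.
Proof.
move=> h; apply/eqP; apply: contrapT => /negP f0.
have [m0 hm0] : exists m0 : nat, forall m, (m0 <= m)%N -> f.[m%:R] != 0.
  have := f0; rewrite -lead_coef_eq0 neq_lt => /orP[|] l.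
    have [|m0 hm0] := @lead_coef_gt0_eventually (- f).
      by rewrite lead_coefN oppr_gt0.
    by exists m0 => m /hm0; rewrite hornerN oppr_gt0 => /lt_eqF ->.
  have [m0 hm0] := lead_coef_gt0_eventually l.
  by exists m0 => m /hm0 /gt_eqF ->.
pose m := maxn K m0.
have := hm0 m (leq_maxr _ _); rewrite -normr_gt0 => fm.
pose n := (Num.trunc (g.[m%:R] / `|f.[m%:R]|)).+1.
have [] := h n isT m (leq_maxl _ _).
rewrite !hornerD hornerN hornerMn => a b.
have : `|f.[m%:R]| *+ n <= g.[m%:R].
  rewrite -normrMn ler_norml; apply/andP; split.
    by rewrite -subr_ge0 opprK.
  by rewrite -subr_ge0 addrC.
apply/negP; rewrite -ltNge -[ltRHS]mulr_natl -ltr_pdivrMr//.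
exact: truncnS_gt.
Qed.

Lemma poly_pos_dominate (d : nat) g : (size g <= d)%N -> poly_pos ('X^d + g).
Proof.
move=> gd; right; rewrite lead_coefDl ?size_polyXn ?ltnS// lead_coefXn.
exact: ltr01.
Qed.

End Polynomials.

(** * Infinitesimals modulo an initial segment of coordinates *)

Section Lift.
Variables (R : realType) (W : wo_ordinal) (A : pos_ord W -> nat -> pos_ord W).
Hypothesis A_fund : fundamental A.
Local Notation V_sort := (dsum (pos_ord W) {poly R}).

Lemma plt_neq (b c : pos_ord W) : plt b c -> b <> c.
Proof. by move=> bc E; move: bc; rewrite E; exact: olt_irr. Qed.

Lemma exists_dsum (u : pos_ord W -> {poly R}) :
  finite_set [set b | u b != 0] -> exists p : V_sort, dsum_fun p = u.
Proof.
move=> fu; have h : u \in @fin_supp R (pos_ord W) {poly R} by apply/asboolP.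
by exists (Dsum h).
Qed.

(** Below [b] one places ['X^m0] at finitely many coordinates, with [m0] such that
[f] is nonnegative at all integers from [m0] on.  This makes the threshold at
[b] at least [m0], and ['X^m0] is itself nonnegative at all naturals, so it
meets the condition at its own coordinate, whatever the threshold is there. *)
Lemma V_wedge_lift (b : pos_ord W) (f : {poly R}) : poly_pos f ->
  exists p : V_sort, [/\ V_wedge A p, p b = f &
    forall c, p c != 0 -> c = b \/ plt c b].
Proof.
move=> f0; have [m0 fm0] := poly_pos_eventually f0.
(* [S] is empty if [b] is 1, the predecessor of [b] if [b] is a successor, and
   the first [m0] points of the fundamental sequence if [b] is a limit. *)
have [S [Sfin Sb Sthr]] : exists S : set (pos_ord W), [/\ finite_set S,
    forall c, S c -> plt c b &
    forall p : V_sort, (forall c, S c -> p c = 'X^m0) ->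
      (m0%:R%:E <= thr A p b)%E].
  have [b1|nb1] := pselect (is_one b).
    exists set0; split=> // p _; rewrite /thr; case: pselect => //= _.
    exact: leey.
  have [bs|nbs] := pselect (exists c, is_succ_of c b).
    exists [set sval (cid bs)]; split=> [//|_ ->|p pS].
      by case: (cid bs) => c [].
    rewrite /thr; case: pselect => //= _; case: pselect => //= bs'.
    rewrite (Prop_irrelevance bs' bs) pS// /poly_deg.
    by rewrite -size_poly_eq0 size_polyXn.
  have [Ainc Ab _] := A_fund (conj nb1 nbs).
  exists [set A b k | k in [set k | (0 < k <= m0)%N]]; split.
  - apply: finite_image; apply: (@sub_finite_set _ _ `I_m0.+1) => [k /andP[]//|].
    exact: finite_II.
  - by move=> _ [k /andP[k0 _] <-]; exact: Ab.
  - move=> p pS; rewrite /thr; case: pselect => //= _; case: pselect => //= _.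
    apply: le_ereal_inf_tmp => _ [n [n0 pn] <-].
    rewrite lee_fin ler_nat leqNgt; apply/negP => nm0.
    have : p (A b n) = 'X^m0 by apply: pS; exists n => //=; rewrite n0 ltnW.
    by rewrite pn => /esym/eqP; rewrite -size_poly_eq0 size_polyXn.
have nSb : ~ S b by move=> /Sb/plt_neq.
pose u (c : pos_ord W) : {poly R} :=
  if `[< c = b >] then f else if `[< S c >] then 'X^m0 else 0.
have ub : u b = f by rewrite /u asboolT.
have uS c : S c -> u c = 'X^m0.
  by move=> Sc; rewrite /u asboolF ?asboolT// => cb; apply: nSb; rewrite -cb.
have u0 c : u c != 0 -> c = b \/ S c.
  by rewrite /u; case: asboolP => [|_]; [left|case: asboolP; [right|rewrite eqxx]].
have [|p pu] := @exists_dsum u.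
  apply: (@sub_finite_set _ _ ([set b] `|` S)) => [c /u0[->|]|]; [by left|by right|].
  by rewrite finite_setU.
exists p; rewrite pu; split=> // [c|c /u0[|/Sb]]; [|by left|by right].
have [->|cb] := pselect (c = b).
  rewrite pu ub; split=> // n n0 tn; apply: fm0.
  have : ((m0%:R : R)%:E <= n%:R%:E)%E.
    by apply: le_trans tn; apply: Sthr => d Sd; rewrite pu uS.
  by rewrite lee_fin ler_nat.
rewrite pu /u asboolF//; case: asboolP => _.
  split; first by right; rewrite lead_coefXn; exact: ltr01.
  by move=> n _ _; rewrite hornerXn exprn_ge0.
by split=> [|n _ _]; [left|rewrite horner0].
Qed.

Implicit Types D : set W.

Definition downset D : Prop := forall c d, olt c d -> D d -> D c.

Definition supp_in D : set (V R A) :=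
  [set p : V_sort | forall b, p b != 0 -> D (sval b)].

(** For an initial segment [D], the supports lie in [D] together with the least
element of its complement.  For empty [D] this is [0], in
agreement with stage 0, because the index set starts at 1. *)
Definition supp_next D : set (V R A) :=
  [set p : V_sort | forall b, p b != 0 -> forall c, olt c (sval b) -> D c].

Lemma supp_in_subspace D : is_subspace (supp_in D).
Proof.
split=> [b|p q Dp Dq b|t p Dp b]; first by rewrite dsum0E eqxx.
  rewrite dsumDE => pq; have [pb|] := eqVneq (p b) 0; last exact: Dp.
  by apply: Dq; move: pq; rewrite pb add0r.
by rewrite dsumZE => tp; apply: Dp; apply: contraNneq tp => ->; rewrite scaler0.
Qed.

Lemma quot_supp_in_eq D (p q : V R A) :
  quot_pi (supp_in D) p = quot_pi (supp_in D) q <->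
  forall b : pos_ord W, ~ D (sval b) -> dsum_fun p b = dsum_fun q b.
Proof.
rewrite quot_piP vspan_id; last exact: supp_in_subspace.
split=> [pq b Db|pq b].
  apply/eqP; rewrite -subr_eq0; apply: contrapT => /negP n0.
  by apply: Db; apply: pq; rewrite dsumDE dsumNE.
rewrite dsumDE dsumNE => n0; apply: contrapT => /pq E.
by move: n0; rewrite E subrr eqxx.
Qed.

Lemma quot_supp_in_wedge D (y : V R A) :
  wedge (povs_quot (supp_in D)) (quot_pi (supp_in D) y) <->
  exists2 p : V R A, wedge (V R A) p &
    forall b : pos_ord W, ~ D (sval b) -> dsum_fun p b = dsum_fun y b.
Proof.
split=> [[p Vp /quot_supp_in_eq E]|[p Vp E]]; exists p => //.
exact/quot_supp_in_eq.
Qed.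

Lemma quot_piMn D (y : V R A) n :
  quot_pi (supp_in D) (y *+ n) = quot_pi (supp_in D) y *+ n.
Proof. exact: raddfMn. Qed.

Lemma quot_piN D (y : V R A) :
  quot_pi (supp_in D) (- y) = - quot_pi (supp_in D) y.
Proof. exact: raddfN. Qed.

Lemma dsumMnE (p : V_sort) n b : (p *+ n) b = p b *+ n.
Proof. by elim: n => [|n ih]; rewrite ?mulr0n// !mulrS dsumDE ih. Qed.

(** Two elements have the same class exactly when they agree outside [D]; this
turns infinitesimality in the quotient into a statement about coordinates. *)
Lemma infinitesimal_quotP D (x : V R A) :
  infinitesimals (povs_quot (supp_in D)) (quot_pi (supp_in D) x) <->
  exists2 xi : V R A, wedge (V R A) xi & forall n, (0 < n)%N ->
    (exists2 p : V R A, wedge (V R A) p & forall b : pos_ord W, ~ D (sval b) ->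
       dsum_fun p b = dsum_fun x b *+ n + dsum_fun xi b) /\
    (exists2 p : V R A, wedge (V R A) p & forall b : pos_ord W, ~ D (sval b) ->
       dsum_fun p b = - (dsum_fun x b *+ n) + dsum_fun xi b).
Proof.
have E (n : nat) (xi : V R A) :
    (wedge (povs_quot (supp_in D))
      (quot_pi (supp_in D) x *+ n + quot_pi (supp_in D) xi) <->
     exists2 p : V R A, wedge (V R A) p & forall b : pos_ord W, ~ D (sval b) ->
       dsum_fun p b = dsum_fun x b *+ n + dsum_fun xi b) /\
    (wedge (povs_quot (supp_in D))
      (- (quot_pi (supp_in D) x *+ n) + quot_pi (supp_in D) xi) <->
     exists2 p : V R A, wedge (V R A) p & forall b : pos_ord W, ~ D (sval b) ->
       dsum_fun p b = - (dsum_fun x b *+ n) + dsum_fun xi b).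
  rewrite -quot_piMn -quot_piN -!quot_piD !quot_supp_in_wedge.
  split; split=> -[p Vp h]; exists p => // b Db; rewrite h//.
  - by rewrite dsumDE dsumMnE.
  - by rewrite dsumDE dsumMnE.
  - by rewrite dsumDE dsumNE dsumMnE.
  - by rewrite dsumDE dsumNE dsumMnE.
split=> [[_ [xi Vxi <-] h]|[xi Vxi h]].
  by exists xi => // n /h[/(E n xi).1 ? /(E n xi).2].
exists (quot_pi (supp_in D) xi); first by exists xi.
by move=> n /h[/(E n xi).1 ? /(E n xi).2].
Qed.

(** Unless its class is zero, modulo [D] such an [x] lives at a single coordinate
[b], the least element outside [D]; there a power of ['X] of degree above that of [x b] dominates all
multiples of [x b], and [V_wedge_lift] repairs the coordinates below. *)
Lemma supp_next_infinitesimal D (x : V R A) :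
  supp_next D x ->
  infinitesimals (povs_quot (supp_in D)) (quot_pi (supp_in D) x).
Proof.
move=> xD; apply/infinitesimal_quotP.
have [xin|] := pselect (supp_in D x).
  exists 0 => [|n n0]; first exact: V_wedge0.
  by split; exists 0; [exact: V_wedge0| |exact: V_wedge0|] => b Db;
     rewrite dsum0E; have [->|/xin//] := eqVneq (dsum_fun x b) 0;
     rewrite mul0rn ?oppr0 addr0.
move=> /existsNP[b /not_implyP[xb nDb]].
have ltD c : olt c (sval b) -> D c by exact: xD.
have notD (c : pos_ord W) : ~ D (sval c) -> c <> b -> olt (sval b) (sval c).
  move=> nDc cb; have [|[E|//]] := olt_total (sval c) (sval b).
    by move=> /ltD.
  by case: cb; case: c b E {nDc xb nDb ltD} => [c pc] [b pb] /=; exact: eq_exist.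
have x0 (c : pos_ord W) : ~ D (sval c) -> c <> b -> dsum_fun x c = 0.
  move=> nDc cb; apply/eqP; apply: contrapT => /negP xc.
  by apply: nDb; apply: xD xc _ (notD c nDc cb).
have lift f : poly_pos f -> exists2 p : V R A, wedge (V R A) p &
    forall c : pos_ord W, ~ D (sval c) ->
      dsum_fun p c = if `[< c = b >] then f else 0.
  move=> f0; have [p [Vp pb pc]] := V_wedge_lift b f0.
  exists p => // c nDc; case: asboolP => [->//|cb].
  apply/eqP; apply: contrapT => /negP /pc[//|cltb].
  by apply: nDc; exact: ltD.
pose d := size (dsum_fun x b).
have [|xi Vxi xiE] := lift 'X^d.
  by have := @poly_pos_dominate R d 0; rewrite addr0 size_poly0; apply.
exists xi => // n n0; split.
  have [|p Vp pE] := lift ('X^d + dsum_fun x b *+ n).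
    by apply: poly_pos_dominate; rewrite -scaler_nat size_scale_leq.
  exists p => // c nDc; rewrite pE// xiE//; case: asboolP => [->|cb].
    by rewrite addrC.
  by rewrite x0// mul0rn addr0.
have [|p Vp pE] := lift ('X^d - dsum_fun x b *+ n).
  by apply: poly_pos_dominate; rewrite size_polyN -scaler_nat size_scale_leq.
exists p => // c nDc; rewrite pE// xiE//; case: asboolP => [->|cb].
  by rewrite addrC.
by rewrite x0// mul0rn oppr0 addr0.
Qed.

(** The coordinates that determine the threshold at [b] are not all in [D], so the
threshold is bounded independently of [n], and [poly_pos_eventually_eq0]
applies at [b]. *)
Lemma infinitesimal_supp_next D (x : V R A) : downset D -> D !=set0 ->
  infinitesimals (povs_quot (supp_in D)) (quot_pi (supp_in D) x) ->
  supp_next D x.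
Proof.
move=> Ddown [d0 Dd0] /infinitesimal_quotP[xi _ h] b xb c cb.
apply: contrapT => nDc.
have pos_c : exists c0, olt c0 c.
  exists d0; have [//|[dc|cd]] := olt_total d0 c; first by rewrite dc in Dd0.
  by case: nDc; exact: Ddown cd Dd0.
pose c' : pos_ord W := exist _ c pos_c.
have nDge (d : pos_ord W) : ~ plt d c' -> ~ D (sval d).
  move=> ndc Dd; apply: nDc.
  have [//|[cd|/ndc//]] := olt_total c (sval d); last by rewrite cd.
  by move=> cd; exact: Ddown cd Dd.
have nDb : ~ D (sval b) by move=> Db; apply: nDc; exact: Ddown cb Db.
(* The boolean [s] selects the sign of [x], so that one [K] serves both. *)
have [K hK] : exists K : nat, forall (n : nat) (s : bool) (p : V R A),
    (forall d : pos_ord W, ~ D (sval d) -> dsum_fun p d =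
      (if s then dsum_fun x d *+ n else - (dsum_fun x d *+ n)) + dsum_fun xi d) ->
    (thr A p b <= K%:R%:E)%E.
  have [bs|nbs] := pselect (exists d, is_succ_of d b).
    (* Successor: the degree at the predecessor [d] is at most that of [x] or [xi]. *)
    pose d := sval (cid bs); have [db dP] : is_succ_of d b := svalP (cid bs).
    exists (maxn (size (dsum_fun x d)) (size (dsum_fun xi d))) => n s p pE.
    rewrite /thr; case: pselect => [/(_ c')//|_ /=].
    case: pselect => //= bs'; rewrite (Prop_irrelevance bs' bs) -/d pE; last first.
      by apply: nDge => dc; apply: (dP c').
    set q := (_ + _)%R; rewrite /poly_deg; case: eqVneq => [_|q0]; first exact: leNye.
    rewrite lee_fin ler_nat; apply: leq_trans (leq_pred _) _.
    apply: leq_trans (size_polyD _ _) _; rewrite geq_max leq_maxr andbT.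
    apply: leq_trans (leq_maxl _ _); case: (s);
      by rewrite ?size_polyN -scaler_nat size_scale_leq.
  (* Limit: some point of the fundamental sequence is outside [D] and outside
     the supports of [x] and [xi]; all the elements [p] vanish there. *)
  have nb1 : ~ is_one b by move=> b1; apply: (b1 c').
  have [Ainc Ab Acof] := A_fund (conj nb1 nbs).
  have [k0 k00 ck0] := Acof c' cb.
  pose F := [set d | dsum_fun x d != 0] `|` [set d | dsum_fun xi d != 0].
  have fF : finite_set F.
    have fin (p : V_sort) : finite_set [set d | p d != 0].
      by case: p => p /= /asboolP.
    by rewrite finite_setU.
  have [k hk] : exists k, forall d, F d ->
      forall m, (k <= m)%N -> (0 < m)%N -> A b m <> d.
    apply: finite_set_directed fF _ => //.
      move=> i j; exists (maxn i j) => t ijt m; rewrite geq_max => /andP[im jm] m0.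
      by case: ijt; apply.
    move=> d _; have [[m [m0 <-]]|nm] := pselect (exists m, (0 < m)%N /\ A b m = d).
      exists m.+1 => m' mm' _ /esym; apply: plt_neq.
      by apply: Ainc; rewrite m0.
    by exists 0%N => m _ m0 E; apply: nm; exists m.
  exists (maxn k0 k) => n s p pE; set m := maxn k0 k.
  have m0 : (0 < m)%N by rewrite leq_max k00.
  rewrite /thr; case: pselect => //= _; case: pselect => //= _.
  apply: ereal_inf_lbound; exists m => //; split=> //.
  have notF : ~ F (A b m) by move=> /hk/(_ m (leq_maxr _ _) m0).
  have [xm xim] : dsum_fun x (A b m) = 0 /\ dsum_fun xi (A b m) = 0.
    by split; apply/eqP; apply: contrapT => /negP h0; apply: notF; [left|right].
  rewrite pE ?xm ?xim; first by case: (s); rewrite mul0rn ?oppr0 addr0.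
  apply: nDge => mc; apply: (@olt_irr _ c).
  have : plt c' (A b m).
    have := leq_maxl k0 k; rewrite -/m leq_eqVlt => /orP[/eqP<-//|k0m].
    by apply: olt_trans ck0 _; apply: Ainc; rewrite k00.
  by move=> cm; exact: olt_trans cm mc.
have : dsum_fun x b = 0.
  apply: (@poly_pos_eventually_eq0 _ _ (dsum_fun xi b) K.+1) => n n0 m Km.
  have [[p Vp pE] [q Vq qE]] := h n n0.
  rewrite -pE// -qE//; split.
    have [_ +] := Vp b; apply; first exact: leq_trans Km.
    by apply: le_trans (hK n true p pE) _; rewrite lee_fin ler_nat ltnW.
  have [_ +] := Vq b; apply; first exact: leq_trans Km.
  by apply: le_trans (hK n false q qE) _; rewrite lee_fin ler_nat ltnW.
by move/eqP; rewrite (negPf xb).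
Qed.

(** If there are earlier stages, their union is the set of elements supported in
[range e], because a finite support in [range e] is bounded by some [e i];
the two lemmas above apply to it. *)
Lemma N_step_supp_next (I : Type) (e : I -> W) (N : I -> set (V R A)) :
  downset (range e) ->
  (forall i, N i = supp_next [set c | olt c (e i)]) ->
  N_step N = supp_next (range e).
Proof.
move=> edown NE; rewrite /N_step; case: asboolP => [I0|nI]; last first.
  apply/seteqP; split=> [_ -> b|p hp]; first by rewrite dsum0E eqxx.
  apply/val_inj/funext => b; apply/eqP; apply: contrapT => /negP pb.
  by have [c cb] := svalP b; have [i] := hp b pb c cb; case: nI.
have -> : \bigcup_i N i = supp_in (range e).
  apply/seteqP; split=> [p [i _]|p hp].
    rewrite NE => hp b pb; have [|[->|ib]] := olt_total (sval b) (e i).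
    - by move=> bi; apply: edown bi _; exists i.
    - by exists i.
    - by have := hp b pb _ ib; move/olt_irr.
  have [i hi] : exists i, forall b : pos_ord W,
      [set b | dsum_fun p b != 0] b -> ~ olt (e i) (sval b).
    apply: finite_set_directed => //.
    - move=> i j; have [ij|ji] := pselect (olt (e i) (e j)).
        exists j => t [it|//] jt; apply: it; exact: olt_trans ij jt.
      exists i => t [//|jt] it; apply: jt.
      have [//|[<-//|ji']] := olt_total (e i) (e j).
      exact: olt_trans it.
    - by case: (p) => p' /= /asboolP.
    - by move=> b /hp[i _ E]; exists i; rewrite E; exact: olt_irr.
  exists i => //; rewrite NE => b pb c cb /=.
  have [ci|[ic|ib]] := olt_total (sval b) (e i).
  - exact: olt_trans ci.
  - by rewrite -ic.
  - by case: (hi b pb).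
apply/seteqP; split=> p hp.
  by apply: infinitesimal_supp_next hp => //; have [i] := I0; exists (e i), i.
exact: supp_next_infinitesimal.
Qed.

(** The well-order [l] varies because the type is minimal among all ordinals; the
supports are indexed by [W], hence the embedding [e]. *)
Lemma N_at_supp_next (l : wo_ordinal) (e : l -> W) (w : l) :
  (forall u v, olt u v -> olt (e u) (e v)) -> downset (range e) ->
  @N_at R (V R A) l w = supp_next [set c | olt c (e w)].
Proof.
move=> emono edown.
have lt_e v : [set c | olt c (e v)] = range (fun u : {u | olt u v} => e (sval u)).
  apply/seteqP; split=> [c cv|_ [[u uv] _ <-]]; last exact: emono.
  have [u _ uc] : range e c by apply: edown cv _; exists v.
  have uv : olt u v.
    have [//|[E|vu]] := olt_total u v; move: cv => /=; rewrite -uc.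
      by rewrite E => /olt_irr.
    by move=> /(olt_trans (emono _ _ vu))/olt_irr.
  by exists (exist _ u uv).
elim/(well_founded_ind (@olt_wf l)): w => w ih.
rewrite N_atE lt_e; apply: N_step_supp_next => [|[v vw]]; last exact: ih.
by rewrite -lt_e => c d; exact: olt_trans.
Qed.

Lemma N_ord_supp_next (l : wo_ordinal) (e : l -> W) :
  (forall u v, olt u v -> olt (e u) (e v)) -> downset (range e) ->
  @N_ord R (V R A) l = supp_next (range e).
Proof.
move=> emono edown; apply: N_step_supp_next => // w.
exact: N_at_supp_next.
Qed.

End Lift.

(** * Stages of a successor ordinal *)

Section Successor_stage.
Variables (R : realType) (X : povs R).

Lemma eq_N_step (I J : Type) (N : I -> set X) (N' : J -> set X) :
  (forall i, exists j, N i = N' j) -> (forall j, exists i, N i = N' j) ->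
  N_step N = N_step N'.
Proof.
move=> NN' N'N; rewrite /N_step.
have -> : \bigcup_i N i = \bigcup_j N' j.
  apply/seteqP; split=> x [i _ xi].
    by have [j E] := NN' i; exists j; rewrite // -E.
  by have [j E] := N'N i; exists j; rewrite // E.
case: asboolP => [[i]|nI]; case: asboolP => [[j]|nJ] //.
  by case: nJ; have [j _] := NN' i.
by case: nI; have [i _] := N'N j.
Qed.

Lemma N_at_osucc (l : wo_ordinal) (w : l) :
  @N_at R X (osucc l) (Some w) = @N_at R X l w.
Proof.
elim/(well_founded_ind (@olt_wf l)): w => w ih; rewrite !N_atE.
apply: eq_N_step => [[[v|//] vw]|[v vw]].
  by exists (exist _ v vw) => /=; exact: ih.
by exists (exist (fun v => osucc_lt v (Some w)) (Some v) vw); exact: ih.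
Qed.

(** The top element of [osucc l] has the stages of [l] as its predecessors, so its
own stage is [N_ord l]. *)
Lemma N_ord_osucc_sub (l : wo_ordinal) :
  @N_ord R X l `<=` @N_ord R X (osucc l).
Proof.
have -> : @N_ord R X l = @N_at R X (osucc l) None.
  rewrite N_atE; apply: eq_N_step => [v|[[v|//] vN]].
    by exists (exist (fun v => osucc_lt v None) (Some v) I); rewrite /= N_at_osucc.
  by exists v; rewrite /= N_at_osucc.
exact: (@N_step_ub _ _ _ (@N_at R X (osucc l))).
Qed.

End Successor_stage.

(** * The first uncountable ordinal *)

Section Omega_one.
Variables (W : wo_ordinal) (W_omega1 : is_omega1 W).

Lemma omega1_min_notin (B : set W) : countable B ->
  exists2 x, ~ B x & forall y, olt y x -> B y.
Proof.
move=> cB; have [|x Bx xmin] := @olt_min W (~` B).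
  apply/set0P/eqP => E; apply: W_omega1.1.
  by rewrite -setC0 -E setCK.
by exists x => // y yx; apply: contrapT => /xmin.
Qed.

Definition segment (w : W) : wo_ordinal.
Proof.
apply: (@WoOrdinal {u | olt u w} (fun x y => olt (sval x) (sval y))).
- by move=> x y z; exact: olt_trans.
- move=> [x xw] [y yw] /=; case: (olt_total x y) => [|[xy|]]; [by left| |by right; right].
  by right; left; exact: eq_exist.
- apply: wf_of_min => B [x Bx].
  have [|_ [y By <-] ymin] := @olt_min W (sval @` B); first by exists (sval x), x.
  by exists y => // z Bz; apply: ymin; exists z.
Defined.

(** An uncountable segment would receive a strictly increasing map from [W], but
no strictly increasing map of a well-order to itself decreases a point. *)
Lemma omega1_segment_countable (w : W) : countable [set u | olt u w].
Proof.
have [cs|ns] := pselect (countable [set: segment w]).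
  apply: sub_countable cs.
  rewrite (_ : [set u | _] = range (fun u : segment w => sval u)).
    exact: card_image_le.
  by apply/seteqP; split=> [u uw|_ [[u uw] _ <-]//]; exists (exist _ u uw).
have [f [fmono _]] := W_omega1.2 _ ns.
have f_ge u : ~ olt (sval (f u)) u.
  elim/(well_founded_ind (@olt_wf W)): u => u ih fu.
  exact: (ih _ fu (fmono _ _ fu)).
by case: (f_ge w (svalP (f w))).
Qed.

Lemma omega1_succ (w : W) :
  exists2 w', olt w w' & forall c, olt c w' -> olt c w \/ c = w.
Proof.
have [|w' nw' w'min] := @omega1_min_notin ([set u | olt u w] `|` [set w]).
  have -> : [set u | olt u w] `|` [set w] =
      \bigcup_(i : bool) (if i then [set u | olt u w] else [set w]).
    apply/seteqP; split=> [u [uw|uw]|u [[] _ uw]]; [|by exists false|by left|by right].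
    by exists true.
  apply: bigcup_countable => [|[] _]; [exact: countableP| |exact: countable1].
  exact: omega1_segment_countable.
exists w' => //; have [|[E|//]] := olt_total w' w.
  by move=> ?; case: nw'; left.
by case: nw'; right.
Qed.

(** Each [w] of [b] goes to the least element of [W] not yet taken; one exists
as only countably many values are taken so far. *)
Lemma countable_segment_embedding (b : wo_ordinal) : countable [set: b] ->
  exists (e : b -> W) (w : W), (forall u v, olt u v -> olt (e u) (e v)) /\
    range e = [set c | olt c w].
Proof.
move=> cb.
have /choice[nx nxP] : forall B : set W, exists x,
    countable B -> ~ B x /\ forall y, olt y x -> B y.
  move=> B; have [/omega1_min_notin[x xB xmin]|nB] := pselect (countable B).
    by exists x.
  by have [x _ _] := omega1_min_notin (countable0 W); exists x.
pose e := Fix (@olt_wf b) (fun=> W) (fun w rec =>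
  nx [set y | exists v (vw : olt v w), rec v vw = y]).
have eE w : e w = nx (e @` [set v | olt v w]).
  rewrite {1}/e Fix_eq => [|x f g fg]; congr nx.
    by apply/seteqP; split=> [y [v [vw <-]]|y [v vw <-]]; exists v => //; exists vw.
  by apply/seteqP; split=> y [v [vw <-]]; exists v, vw.
have cimg (B : set b) : countable (e @` B).
  apply: sub_countable (card_image_le _ _) _.
  by apply: sub_countable cb; exact: subset_card_le.
have eP w : ~ (e @` [set v | olt v w]) (e w) /\
    forall y, olt y (e w) -> (e @` [set v | olt v w]) y.
  by rewrite eE; exact: nxP.
have edown : downset (range e).
  by move=> c d cd [v _ E]; move: cd; rewrite -E => /(eP v).2[u _ <-]; exists u.
have [w nw wmin] := omega1_min_notin (cimg setT).
exists e, w; split=> [u v uv|].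
  have [//|[E|vu]] := olt_total (e u) (e v).
    by case: (eP v).1; exists u.
  case: (eP v).1; have [t tu <-] := (eP u).2 _ vu; exists t => //.
  exact: olt_trans uv.
apply/seteqP; split=> [c ec|c]; last exact: wmin.
have [//|[E|wc]] := olt_total c w; first by rewrite E in ec.
by case: nw; exact: edown wc ec.
Qed.

End Omega_one.

(** * The almost Archimedeanization type *)

Theorem corollary4p1 (R : realType) (W : wo_ordinal) (W_omega1 : is_omega1 W)
    (A : pos_ord W -> nat -> pos_ord W) (A_fund : fundamental A) :
  is_aa_type (V R A) W.
Proof.
split.
  have NW : @N_ord R (V R A) W = setT.
    have idown : downset (range (@id W)) by move=> c d _ _; exists c.
    rewrite (@N_ord_supp_next R W A A_fund W id)//.
    by apply/seteqP; split=> // p _ b _ c _; exists c.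
  rewrite NW; apply/seteqP; split=> // p _.
  by apply: (@N_ord_osucc_sub R (V R A) W); rewrite NW.
move=> b Nb; have [cb|] := pselect (countable [set: b]); last exact: W_omega1.2.
have [e [w [emono erange]]] := countable_segment_embedding W_omega1 cb.
have [w' ww' w'min] := omega1_succ W_omega1 w.
have elt u : olt (e u) w by have : range e (e u) by [exists u]; rewrite erange.
(* [osucc b] has to be embedded as well, which is why [range e] must be proper. *)
pose e' (u : osucc b) : W := if u is Some v then e v else w.
have e'mono u v : olt u v -> olt (e' u) (e' v).
  by case: u v => [u|] [v|] //=; exact: emono.
have e'range : range e' = [set c | olt c w'].
  apply/seteqP; split=> [_ [[u|] _ <-]//=|c /w'min[cw|->]].
  - exact: olt_trans ww'.
  - have : range e c by rewrite erange.
    by move=> [u _ <-]; exists (Some u).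
  - by exists None.
have down v : downset [set c : W | olt c v] by move=> c d; exact: olt_trans.
move: Nb; rewrite (N_ord_supp_next R A_fund emono) ?erange//.
rewrite (N_ord_supp_next R A_fund e'mono) ?e'range// => E; exfalso.
pose b' : pos_ord W := exist _ w' (ex_intro _ w ww').
have [|p pE] := @exists_dsum R W (fun c => if `[< c = b' >] then 1 else 0).
  apply: (@sub_finite_set _ _ [set b']) => // c /=.
  by case: asboolP => // _; rewrite eqxx.
have : supp_next [set c | olt c w'] (p : V R A).
  by move=> c; rewrite pE; case: asboolP => [->//|_]; rewrite eqxx.
rewrite E => /(_ b'); rewrite pE asboolT// oner_eq0 => /(_ isT w ww').
exact: olt_irr.
Qed.
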